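(* Every finite or infinite Sturmian word $w$ over $\Sigma=\{a,b\}$ is uniquely determined, up to isomorphisms of the alphabet $\Sigma$, by its sequence $\mathit{oc}(w)$ of open and closed prefixes. That is, if $w$ and $w'$ are (finite or infinite) Sturmian words over $\Sigma$ with $\mathit{oc}(w)=\mathit{oc}(w')$, then either $w'=w$ or $w'$ is obtained from $w$ by exchanging the letters $a$ and $b$.
   Context: Let $\Sigma=\{a,b\}$. An infinite word $w\in\Sigma^{\omega}$ is a Sturmian word if for every $n\ge 0$ it has exactly $n+1$ distinct factors of length $n$. A finite Sturmian word is a finite factor of an infinite Sturmian word; equivalently, a word $w\in\Sigma^*$ such that for all factors $u,v$ of $w$ with $|u|=|v|$ one has $\bigl||u|_a-|v|_a\bigr|\le 1$, where $|u|_a$ is the number of occurrences of $a$ in $u$. A finite word $w$ is closed if it is empty or has a factor $v\neq w$ (possibly empty) occurring exactly twice in $w$, once as a prefix and once as a suffix (the two occurrences may overlap; the empty word has $|w|+1$ occurrences in $w$). A word that is not closed is open. For a finite or infinite word $w$, $\mathit{oc}(w)$ is the sequence, indexed by $n\ge 1$ (with $n\le |w|$ if $w$ is finite), whose $n$-th element is $1$ if the prefix of length $n$ of $w$ is closed, and $0$ otherwise. *)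

(* Defs.v *)
From HB Require Import structures.
From mathcomp Require Import all_boot.

Set Implicit Arguments.
Unset Strict Implicit.
Unset Printing Implicit Defensive.

Variant letter := La | Lb.

Definition letter_is_a (c : letter) : bool := if c is La then true else false.
Definition letter_of_bool (t : bool) : letter := if t then La else Lb.

Lemma letter_is_aK : cancel letter_is_a letter_of_bool.
Proof. by case. Qed.

HB.instance Definition _ := Finite.copy letter (can_type letter_is_aK).

Definition swap (c : letter) : letter := if c is La then Lb else La.

(* A finite or infinite sequence; [Inf x] has x 0 as its first element. *)
Variant word (A : Type) := Fin of seq A | Inf of (nat -> A).

Definition map_word (A B : Type) (h : A -> B) (w : word A) : word B :=
  match w with
  | Fin s => Fin (map h s)
  | Inf x => Inf (fun i => h (x i))
  end.

Definition factor_inf (A : Type) (u : seq A) (x : nat -> A) : Prop :=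
  exists i, u = mkseq (fun j => x (i + j)) (size u).

(* The list s enumerates without repetition the factors of length n. *)
Definition sturmian_inf (x : nat -> letter) : Prop :=
  forall n, exists s : seq (seq letter),
    [/\ uniq s, size s = n.+1 &
        forall u, u \in s <-> size u = n /\ factor_inf u x].

Definition sturmian (w : word letter) : Prop :=
  match w with
  | Fin s => exists2 x, sturmian_inf x & factor_inf s x
  | Inf x => sturmian_inf x
  end.

Section ClosedWords.
Variable A : eqType.
Implicit Types u v w : seq A.

(* Position [size w] is included, so the empty word has |w| + 1 occurrences. *)
Definition occurrences v w : seq nat :=
  [seq i <- iota 0 (size w).+1 | prefix v (drop i w)].

Definition closed_word w : Prop :=
  w = [::] \/
  exists v, [/\ v <> w, prefix v w, suffix v w & size (occurrences v w) = 2].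

(* A prefix v <> w of w is [take k w] for some k < |w|. *)
Definition closedb w : bool :=
  (w == [::]) ||
  [exists k : 'I_(size w),
     suffix (take k w) w && (size (occurrences (take k w) w) == 2)].

Lemma closedP w : reflect (closed_word w) (closedb w).
Proof.
apply: (iffP orP) => [[/eqP|/existsP[k /andP[sv /eqP ov]]]|[->|]]; first by left.
- right; exists (take k w); split=> //; last exact: prefix_take.
  by move=> /(congr1 size) /eqP; rewrite size_take ltn_ord ltn_eqF.
- by left.
case=> v [vw pv sv ov]; right; apply/existsP.
have Ev : v = take (size v) w by apply/esym/eqP; rewrite -prefixE.
have lt_vw : size v < size w.
  rewrite ltnNge; apply/negP=> le_wv; apply: vw.
  by rewrite Ev take_oversize.
by exists (Ordinal lt_vw); rewrite /= -Ev sv ov eqxx.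
Qed.

(* The entry for the prefix of length n has index n - 1; [true] stands for 1. *)
Definition oc (w : word A) : word bool :=
  match w with
  | Fin s => Fin (mkseq (fun i => closedb (take i.+1 s)) (size s))
  | Inf x => Inf (fun i => closedb (mkseq x i.+1))
  end.

End ClosedWords.

(* Main.v *)
(* Let [p] be the longest common prefix of two Sturmian words with the same
   first letter, so that both [pa] and [pb] are Sturmian.  Exactly one of them is
   closed, hence the oc-sequences differ there.  Indeed let [v] be the longest
   prefix of [p] that occurs again in [p], and let [c] be the letter following the
   prefix [v].  If [v] is a suffix of [p], then appending [c], and only [c], gives
   a closed word.  Otherwise [v] is followed by both letters in [p]; comparing
   [v] with [p] from the right gives a word [s] and letters [e <> f] such that
   [es] is a suffix of [v] and [fs] one of [p], so [ese] and [fsf] both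
   occur in [pf], which contradicts balance. *)
Require Import Defs.
From mathcomp Require Import all_boot.
From Stdlib Require Import FunctionalExtensionality.
From mathcomp Require Import zify.

Set Implicit Arguments.
Unset Strict Implicit.
Unset Printing Implicit Defensive.

(** * Positions where two words disagree *)

Lemma first_difference (T : eqType) (u v : seq T) :
  size u = size v -> u <> v ->
  exists p c d u' v', [/\ u = p ++ c :: u', v = p ++ d :: v' & c <> d].
Proof.
elim: u v => [|c u IH] [|d v] //= [suv] neq.
have [ecd|/eqP ncd] := eqVneq c d; last by exists [::], c, d, u, v.
have nuv : u <> v by move=> e; apply: neq; rewrite ecd e.
have [p [c' [d' [u' [v' [-> -> ne]]]]]] := IH v suv nuv.
by exists (d :: p), c', d', u', v'; rewrite ecd.
Qed.

Lemma last_difference (T : eqType) (r u : seq T) :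
  size r <= size u -> ~~ suffix r u ->
  exists r' c u' d s, [/\ r = r' ++ c :: s, u = u' ++ d :: s & c <> d].
Proof.
elim/last_ind: r u => [|r c IH] u; first by rewrite suffix0s.
case/lastP: u => [|u d]; rewrite ?size_rcons // ltnS => sru.
rewrite suffix_rcons; have [<- /= nsuf|/eqP ncd _] := eqVneq c d; last first.
  by exists r, c, u, d, [::]; rewrite !cats1.
have [r' [c' [u' [d' [s [-> -> ne]]]]]] := IH u sru nsuf.
by exists r', c', u', d', (rcons s c); rewrite !rcons_cat.
Qed.

Lemma swap_neq (c d : letter) : c <> d -> d = swap c.
Proof. by case: c; case: d. Qed.

Lemma swapK : involutive swap.
Proof. by case. Qed.

(** * Factors of infinite words *)

Section Factors.
Variable A : eqType.
Implicit Types (x : nat -> A) (u v : seq A).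

(** Written exactly as in [factor_inf], so that an occurrence folds into a block. *)
Definition block x n i := mkseq (fun j => x (i + j)) n.

Lemma size_block x n i : size (block x n i) = n.
Proof. exact: size_mkseq. Qed.

Lemma nth_block a x n i j : j < n -> nth a (block x n i) j = x (i + j).
Proof. exact: nth_mkseq. Qed.

Lemma block_factor x n i : factor_inf (block x n i) x.
Proof. by exists i; rewrite size_block. Qed.

Lemma blockS x n i : block x n.+1 i = rcons (block x n i) (x (i + n)).
Proof. by rewrite /block /mkseq -addn1 iotaD map_cat cats1. Qed.

Lemma block_cat x m n i : block x (m + n) i = block x m i ++ block x n (i + m).
Proof.
apply: (@eq_from_nth _ (x 0)) => [|j]; rewrite ?size_cat !size_block // => lt_j.
rewrite nth_block // nth_cat size_block; case: ltnP => le_j.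
  by rewrite nth_block.
by rewrite nth_block -?addnA ?subnKC // ltn_subLR.
Qed.

Lemma block_cons x n i : block x n.+1 i = x i :: block x n i.+1.
Proof. by rewrite -addn1 addnC block_cat addn1 /block /= addn0. Qed.

Lemma infix_factor x u v : infix u v -> factor_inf v x -> factor_inf u x.
Proof.
case/infixP => p [q ->] [i]; rewrite !size_cat -/(block _ _ _) !block_cat => e.
exists (i + size p); rewrite -/(block _ _ _).
have /eqP := e; rewrite eqseq_cat ?size_block // => /andP[_].
by rewrite eqseq_cat ?size_block // => /andP[/eqP].
Qed.

End Factors.

(** * Unbalanced pairs in a factor-closed language *)

Section Unbalanced.
Variable F : seq letter -> Prop.
Hypothesis F_infix : forall u v, infix u v -> F v -> F u.

(* Shortest unbalanced pairs have the form [a p a], [b p b] with [p] a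
   palindrome; any other shape contains a shorter unbalanced pair. *)
Lemma unbalanced_palindrome u v :
  size u = size v -> F u -> F v ->
  count_mem La v + 2 <= count_mem La u ->
  exists p, [/\ rev p = p, F (La :: rcons p La) & F (Lb :: rcons p Lb)].
Proof.
have [n] := ubnP (size u); elim: n u v => // n IH u v.
have shorter (u' v' w z : seq letter) : size u' < n -> size u' = size v' ->
    infix u' w -> infix v' z -> F w -> F z ->
    count_mem La v' + 2 <= count_mem La u' ->
    exists p, [/\ rev p = p, F (La :: rcons p La) & F (Lb :: rcons p Lb)].
  by move=> lt_n e iu iv Fw Fz; apply: IH => //; apply: F_infix; eauto.
case: u v => [|c u] [|d v] //=.
rewrite ltnS => lt_n [suv] Fu Fv cnt.
have tl l e (F_ : F (l :: e)) : F e.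
  exact: F_infix (infix_cons _ _) F_.
have [/(shorter u v u v)|] := leqP (count_mem La v + 2) (count_mem La u).
  by apply; rewrite ?infix_refl //; apply: tl; eauto.
(* The tails are no longer unbalanced, so the first letters are [La] in [u] and [Lb] in [v], and the
   tail of [u] has exactly one more [La]. *)
move: cnt Fu Fv; case: c; case: d => /=; rewrite ?add0n ?add1n; try lia.
move=> cnt Fu Fv cnt'.
have nuv : u <> v by move=> e; move: cnt; rewrite e; lia.
have [p [c [d [u' [v' [eu ev /swap_neq ed]]]]]] : exists (p : seq letter) c d u' v',
    [/\ u = p ++ c :: u', v = p ++ d :: v' & c <> d].
  exact: first_difference.
move: suv lt_n cnt Fu Fv; rewrite eu ev {eu ev d}ed !count_cat !size_cat /=.
(* If the tail of [u] continued with [Lb] and that of [v] with [La], the remainders would form a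
   shorter unbalanced pair. *)
case: c => /= suv lt_n cnt Fu Fv; last first.
  have cnt2 : count_mem La v' + 2 <= count_mem La u' by move: cnt => /=; lia.
  apply: (shorter u' v' _ _ _ _ _ _ Fu Fv cnt2); try lia.
    by rewrite -cat1s -cat_rcons !catA; apply/infix_catl/infix_refl.
  by rewrite -cat1s -cat_rcons !catA; apply/infix_catl/infix_refl.
have Fp : F (La :: rcons p La).
  by apply: F_infix Fu; rewrite -cat_rcons -cat_cons; apply/infix_catr/infix_refl.
have Fp' : F (Lb :: rcons p Lb).
  by apply: F_infix Fv; rewrite -cat_rcons -cat_cons; apply/infix_catr/infix_refl.
have [pal|/eqP] := eqVneq (rev p) p; first by exists p.
move=> /nesym neq.
(* If [p] first disagrees with its reversal after [t], then [p] starts with [t c] and ends with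
   [d (rev t)]. The borders of [l p l] complete these to [c t c] and [d (rev t) d], a shorter
   unbalanced pair. *)
have [t [c [d [p2 [p3 [ep erp /swap_neq ed]]]]]] : exists (t : seq letter) c d p2 p3,
    [/\ p = t ++ c :: p2, rev p = t ++ d :: p3 & c <> d].
  by apply: first_difference neq; rewrite size_rev.
have ep' : p = rev p3 ++ d :: rev t.
  by rewrite -[LHS]revK erp rev_cat rev_cons cat_rcons.
have st : size t < size p by rewrite ep size_cat /=; lia.
have pre l : infix (l :: rcons t c) (l :: rcons p l).
  by rewrite ep rcons_cat rcons_cons -cat_rcons -cat_cons; apply/infix_catr/infix_refl.
have suf l : infix (d :: rcons (rev t) l) (l :: rcons p l).
  by rewrite ep' rcons_cat rcons_cons -cat_cons; apply/infix_catl/infix_refl.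
move: ed suf => -> {ep erp ep'}; case: c pre => pre suf.
- apply: (shorter _ _ _ _ _ _ (pre La) (suf Lb) Fp Fp');
    rewrite /= ?size_rcons ?size_rev -?cats1 ?count_cat ?count_rev /=; lia.
- apply: (shorter _ _ _ _ _ _ (suf La) (pre Lb) Fp Fp');
    rewrite /= ?size_rcons ?size_rev -?cats1 ?count_cat ?count_rev /=; lia.
Qed.

(** Makes the middle word a palindrome, as the mirror argument in [sturmian_balanced] requires. *)
Lemma unbalanced_same_palindrome c d s :
  c <> d -> F (c :: rcons s c) -> F (d :: rcons s d) ->
  exists p, rev p = p /\ forall l, F (l :: rcons p l).
Proof.
have main : F (La :: rcons s La) -> F (Lb :: rcons s Lb) ->
    exists p, rev p = p /\ forall l, F (l :: rcons p l).
  move=> Fa Fb.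
  have [||p [pal Fpa Fpb]] := unbalanced_palindrome _ Fa Fb.
  - by rewrite /= !size_rcons.
  - by rewrite -!cats1 /= !count_cat /=; lia.
  - by exists p; split=> // -[].
by case: c; case: d => // _ F1 F2; apply: main.
Qed.

End Unbalanced.

(** * Right special factors and balance of Sturmian words *)

Definition special (x : nat -> letter) (z : seq letter) :=
  forall c, factor_inf (rcons z c) x.

Section Sturmian.
Variable x : nat -> letter.
Hypothesis x_sturmian : sturmian_inf x.

(** Eventual periodicity leaves at most [N = i + p] factors of length [N], one fewer than needed. *)
Lemma sturmian_aperiodic i p : 0 < p -> ~ (forall k, i <= k -> x (k + p) = x k).
Proof.
move=> p_gt0 per; pose N := i + p.
have early k : exists2 k', k' < N & block x N k = block x N k'.
  have [m] := ubnP k; elim: m k => // m IH k lt_km.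
  have [lt_kN|le_Nk] := ltnP k N; first by exists k.
  have [|k' lt_k' e] := IH (k - p); first by rewrite /N in le_Nk; lia.
  exists k' => //; rewrite -e; apply: (@eq_from_nth _ La); rewrite ?size_block //.
  move=> j lt_j; rewrite !nth_block //; rewrite /N in le_Nk.
  by rewrite -(per (k - p + j)); [congr x|]; lia.
have [s [us ss mem_s]] := x_sturmian N.
suff : size s <= size (map (block x N) (iota 0 N)).
  by rewrite ss size_map size_iota ltnn.
apply: uniq_leq_size => // u /mem_s[su [k eu]].
have [k' lt_k' e] := early k; apply/mapP; exists k'; first by rewrite mem_iota.
by rewrite -e eu su.
Qed.

(** Pigeonhole: deleting the last letter maps [n + 2] factors to [n + 1], so two of them share a
    prefix of length [n]. *)
Lemma special_exists n : exists2 z, size z = n & special x z.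
Proof.
have [s [us ss mem_s]] := x_sturmian n.
have [t [ut st mem_t]] := x_sturmian n.+1.
have pre c z : rcons z c \in t -> z \in s.
  move=> /mem_t[]; rewrite size_rcons => -[sz] Fz; apply/mem_s; split=> //.
  exact: infix_factor (infix_rcons _ _) Fz.
have [/hasP[z sz /andP[za zb]]|no] :=
  boolP (has (fun z => (rcons z La \in t) && (rcons z Lb \in t)) s).
  have /mem_s[] := sz; exists z => // -[]; [have /mem_t[]:= za|have /mem_t[]:= zb]; done.
suff : size t <= size s by rewrite ss st ltnn.
rewrite -(size_map (take n)).
have t_rcons u : u \in t -> exists z c, u = rcons z c /\ take n u = z.
  move=> /mem_t[su _]; case/lastP: u su => // z c; rewrite size_rcons => -[<-].
  by exists z, c; rewrite -cats1 take_size_cat.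
apply: uniq_leq_size => [|_ /mapP[u tu ->]]; last first.
  by have [z [c [eu ->]]] := t_rcons u tu; apply: (pre c); rewrite -eu.
rewrite map_inj_in_uniq // => u v tu tv.
have [z [c [eu ->]]] := t_rcons u tu; have [z' [d [ev ->]]] := t_rcons v tv.
move=> ez; rewrite eu ev -ez; congr rcons.
move: tu tv; rewrite eu ev -ez => tu tv.
have /hasPn/(_ _ (pre _ _ tu)) := no.
by case: c tu {eu}; case: d tv {ev} => // -> ->.
Qed.

(** Every factor extends to the right, and each special one extends twice; two special factors of
    length [n] would give [n + 3] factors of length [n + 1]. *)
Lemma special_unique z1 z2 :
  size z1 = size z2 -> special x z1 -> special x z2 -> z1 = z2.
Proof.
move=> e12 sp1 sp2; apply/eqP; apply/negP => /negP n12.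
have [s [us ss mem_s]] := x_sturmian (size z1).
have [t [ut st mem_t]] := x_sturmian (size z1).+1.
(* [ext] prefers [La], so for a special [z] the word [rcons z Lb] is an additional factor. *)
pose ext z := if rcons z La \in t then La else Lb.
have t_sp z c : size z = size z1 -> special x z -> rcons z c \in t.
  by move=> sz sp; apply/mem_t; rewrite size_rcons sz.
pose L := [:: rcons z1 Lb; rcons z2 Lb] ++ [seq rcons z (ext z) | z <- s].
suff : size L <= size t by rewrite /L /= size_map ss st ltnn.
apply: uniq_leq_size.
  have notin z : size z = size z1 -> special x z ->
      rcons z Lb \notin [seq rcons z (ext z) | z <- s].
    move=> sz sp; apply/mapP => -[z' _ /rcons_inj[<-]].
    by rewrite /ext t_sp.
  rewrite /= inE negb_or !notin // map_inj_uniq ?us ?andbT; last first.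
    by move=> u v /rcons_inj[].
  by apply/eqP => /rcons_inj[] /eqP; rewrite (negPf n12).
move=> u; rewrite !inE => /orP[/eqP->|/orP[/eqP->|/mapP[z sz ->]]]; try exact: t_sp.
rewrite /ext; case: ifP => // na; have /mem_s[size_z [i ez]] := sz.
have tz : rcons z (x (i + size z)) \in t.
  apply/mem_t; split; first by rewrite size_rcons size_z.
  have -> : rcons z (x (i + size z)) = block x (size z).+1 i.
    by rewrite blockS /block -ez.
  exact: block_factor.
by move: tz; case: (x _) => //; rewrite na.
Qed.

Lemma deterministic n k l :
  ~ special x (block x n k) -> block x n k = block x n l ->
  x (k + n) = x (l + n).
Proof.
move=> nsp e; have [//|/eqP ne] := eqVneq (x (k + n)) (x (l + n)).
case: nsp; have el := swap_neq ne.
have Fk : factor_inf (rcons (block x n k) (x (k + n))) x.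
  by rewrite -blockS; apply: block_factor.
have Fl : factor_inf (rcons (block x n k) (x (l + n))) x.
  by rewrite e -blockS; apply: block_factor.
by move: el Fk Fl; case: (x (k + n)) => /= -> Fk Fl [].
Qed.

(* Only [n] factors of length [n] are not special, so a block of length [n]
   repeats in the run, and the word is periodic from there. *)
Lemma special_in_run n m :
  ~ (forall i, m <= i <= m + n -> ~ special x (block x n i)).
Proof.
move=> nsp; have [z sz spz] := special_exists n.
have [s [us ss mem_s]] := x_sturmian n.
have zs : z \in s by apply/mem_s; split=> //; apply: infix_factor (infix_rcons z La) (spz La).
have : ~~ uniq (map (block x n) (iota m n.+1)).
  apply/negP => u_bl.
  suff : size (map (block x n) (iota m n.+1)) <= size (rem z s).
    by rewrite size_map size_iota size_rem // ss ltnn.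
  apply: uniq_leq_size => // _ /mapP[i i_run ->].
  rewrite mem_iota in i_run; rewrite mem_rem_uniq // inE; apply/andP; split.
    by apply/eqP => e; apply: (nsp i); [lia|rewrite e].
  by apply/mem_s; rewrite size_block; split=> //; apply: block_factor.
case/(uniqPn [::]) => i0 [j0 []]; rewrite size_map size_iota => lt_ij lt_j.
rewrite !(nth_map 0) ?size_iota ?nth_iota //; try lia.
set i := m + i0; set j := m + j0 => eij.
have next k l : ~ special x (block x n k) -> block x n k = block x n l ->
    block x n k.+1 = block x n l.+1.
  move=> nspk e; have := deterministic nspk e; move: e.
  case: n {nsp sz ss mem_s lt_j eij spz zs nspk} => [|n] // e.
  rewrite !blockS => e'.
  move: e; rewrite !block_cons => -[_ ->].
  by rewrite -!addSnnS in e'; rewrite e'.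
(* Equal non-special blocks have equal successors, so from [i] on the blocks cycle through those
   starting in [[i, j)], none of which is special. *)
have back k : i <= k -> exists2 k', i <= k' < j & block x n k = block x n k'.
  elim: k => [|k IH] le_ik; first by exists i => //; [lia|congr block; lia].
  have [e_ik|lt_ik] := eqVneq i k.+1; first by exists k.+1 => //; rewrite -e_ik /i /j; lia.
  have [|k' k'_run e] := IH; first by lia.
  have e' := next k' k (nsp k' _) (esym e).
  have [ej|nej] := eqVneq k'.+1 j.
    by exists i; [lia|rewrite -e' ?ej //; lia].
  by exists k'.+1; [lia|rewrite -e' //; lia].
have nsp_i k : i <= k -> ~ special x (block x n k).
  by move=> /back[k' k'_run ->]; apply: nsp; lia.
have per k : i <= k -> block x n k = block x n (k + (j - i)).
  elim: k => [|k IH] le_ik.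
    have i0E : i = 0 by lia.
    by rewrite add0n -[in LHS]i0E eij i0E subn0.
  have [<-|ne] := eqVneq i k.+1; first by rewrite subnKC //; lia.
  by rewrite addSn; apply: next; [apply: nsp_i|apply: IH]; lia.
(* The threshold is [i + n] because the letter at [k] is read as the one following the block at
   [k - n]. *)
apply: (@sturmian_aperiodic (i + n) (j - i)); first by lia.
move=> k le_k; have le' : i <= k - n by lia.
have := deterministic (nsp_i _ le') (per _ le').
by rewrite addnAC subnK; [move=> ->|lia].
Qed.

(** Otherwise some palindrome [p] is special, and the special factor one letter longer is [e p] for
    some letter [e]. No occurrence of [e p] starts inside an occurrence of [p] bordered on both
    sides by [swap e], which contradicts [special_in_run]. *)
Lemma sturmian_balanced c d s :
  c <> d -> ~ (factor_inf (c :: rcons s c) x /\ factor_inf (d :: rcons s d) x).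
Proof.
move=> ncd [Fc Fd].
have [p [pal Fp]] :=
  unbalanced_same_palindrome (@infix_factor _ x) ncd Fc Fd.
have sp_p : special x p by move=> l; apply: infix_factor (infix_cons _ _) (Fp l).
have [[//|e p'] [sz] spz] := special_exists (size p).+1.
(* A suffix of a special factor is special. *)
have ep : p' = p.
  apply: special_unique => // l.
  by apply: infix_factor (spz l); rewrite rcons_cons; apply: infix_cons.
move: spz; rewrite ep {p' sz ep} => spz.
have [m] := Fp (swap e); rewrite /= size_rcons -/(block _ _ _) blockS block_cons.
rewrite -rcons_cons => /rcons_inj[[em epm] eM].
have at_p k : k < size p -> x (m + k.+1) = nth La p k.
  by move=> lt_k; rewrite epm nth_block ?addSnnS.
have neq_e : swap e <> e by case: (e).
(* [swap e], [p], [swap e] occurs at [m].  An occurrence of [e], [p] starting in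
   it covers the last [swap e]; mirrored in the palindrome [p], that letter
   falls on the leading [e]. *)
apply: (@special_in_run (size p).+1 m) => i run_i sp_i.
have : block x (size p).+1 i = e :: p.
  by apply: special_unique; rewrite ?size_block.
rewrite block_cons => -[ei epi].
have [i_m|i_ne_m] := eqVneq i m; first by case: neq_e; rewrite em -i_m.
have [i_M|i_ne_M] := eqVneq i (m + (size p).+1).
  by case: neq_e; rewrite eM -i_M.
pose k := i - m.+1.
have lt_k : k < size p by rewrite /k; lia.
have ek : nth La p k = e by rewrite -at_p // -ei; congr x; rewrite /k; lia.
have : nth La p k = swap e.
  rewrite -pal nth_rev // eM -[X in nth _ X _]epi nth_block; last by lia.
  by congr x; rewrite /k; lia.
by rewrite ek => /esym.
Qed.

End Sturmian.

(** * Closed words obtained by appending one letter *)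

Section Closed.
Variable A : eqType.
Implicit Types p u v w : seq A.

Lemma prefix_rcons2 u w c d :
  prefix (rcons u c) (rcons w d) =
  prefix (rcons u c) w || (rcons u c == rcons w d).
Proof.
apply/prefixP/orP => [[t]|[/prefixP[t ->]|/eqP->]].
- case/lastP: t => [|t e]; first by rewrite cats0 => ->; right.
  rewrite -rcons_cat => /rcons_inj[-> _]; left; exact: prefix_prefix.
- by exists (rcons t d); rewrite rcons_cat.
- by exists [::]; rewrite cats0.
Qed.

(* [v] is the longest repeated prefix of [p]; the letter [c] that follows its
   prefix occurrence is the one whose appending closes [p]. *)
Definition closing p c v :=
  [/\ prefix (rcons v c) p, suffix v p &
      forall i, prefix (rcons v c) (drop i p) -> i = 0].

Lemma closing_size p c v : closing p c v -> size v < size p.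
Proof. by case=> /size_prefix; rewrite size_rcons. Qed.

(** The occurrences of [v c] in [p c] are those in [p], hence only position 0, and the final one. *)
Lemma closing_closed p c v : closing p c v -> closed_word (rcons p c).
Proof.
move=> cl; have lt_vp := closing_size cl; case: cl => pv sv uniq_v.
right; exists (rcons v c).
have [q ep] := suffixP sv.
split.
- by move/rcons_inj => [ev]; rewrite ev ltnn in lt_vp.
- exact: prefix_trans pv (prefix_rcons _ _).
- by rewrite suffix_rcons eqxx.
have q_gt0 : 0 < size q by move: lt_vp; rewrite ep size_cat; lia.
suff : perm_eq (occurrences (rcons v c) (rcons p c)) [:: 0; size q].
  by move/perm_size.
apply: uniq_perm; first by rewrite filter_uniq ?iota_uniq.
  by rewrite /= inE andbT; lia.
move=> i; rewrite mem_filter mem_iota !inE size_rcons /= add0n.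
have [le_ip|lt_pi] := leqP i (size p); last first.
  rewrite drop_oversize ?size_rcons //.
  have -> : prefix (rcons v c) [::] = false by case: (v).
  by rewrite ep size_cat in lt_pi; lia.
have -> /= : i < (size p).+2 by lia.
rewrite andbT drop_rcons // prefix_rcons2; apply/orP/orP.
- case=> [/uniq_v->|/eqP/rcons_inj[ev]]; [by left|right].
  by have := congr1 size ev; rewrite size_drop ep size_cat in le_ip *; lia.
- case=> /eqP->; first by left; rewrite drop0.
  by right; rewrite ep drop_size_cat.
Qed.

Lemma closed_closing p c : p <> [::] -> closed_word (rcons p c) ->
  exists v, closing p c v.
Proof.
move=> p_neq0; case; first by case: (p).
case=> v; case/lastP: v => [|v c'] [nvp pv].
  (* The empty word cannot be the witness: it occurs [size p + 2 > 2] times in [rcons p c]. *)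
  case: p {pv} nvp p_neq0 => // e p _ _ _.
  by rewrite /occurrences (eq_filter (a2 := predT)) ?filter_predT ?size_iota ?size_rcons //;
    move=> i; rewrite prefix0s.
rewrite suffix_rcons => /andP[/eqP ec sv] occ2; move: ec nvp pv occ2 => ->.
rewrite prefix_rcons2 => /eqP/negPf->; rewrite orbF => pv occ2.
exists v; split=> // i pi; apply/eqP; rewrite -leqn0 leqNgt; apply/negP => i_gt0.
have [q ep] := suffixP sv.
have le_i : i + (size v).+1 <= size p.
  by have := size_prefix pi; rewrite size_rcons size_drop; lia.
(* An occurrence inside [p] at [i > 0] would be a third one, strictly between the prefix and the
   suffix occurrences. *)
suff : size [:: 0; i; size q] <= size (occurrences (rcons v c) (rcons p c)).
  by rewrite occ2.
apply: uniq_leq_size => [|j]; first by rewrite /= !inE; rewrite ep size_cat in le_i; lia.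
rewrite !inE mem_filter mem_iota size_rcons add0n.
have le_j k : k <= size p -> 0 <= k < (size p).+2 by lia.
case/or3P => /eqP->; rewrite le_j ?andbT ?drop_rcons ?prefix_rcons2 ?pi //; try lia.
- by rewrite drop0 pv.
- by rewrite ep drop_size_cat // eqxx orbT.
- by rewrite ep size_cat leq_addr.
- by rewrite ep size_cat leq_addr.
Qed.

(** If [v] is shorter than [w], then [v c] is a prefix of [w] and recurs where [w] ends [p], against
    its uniqueness. If the lengths agree, [v c] and [w d] are the same prefix of [p]. *)
Lemma closing_unique p c d v w : closing p c v -> closing p d w -> c = d.
Proof.
have prefix_le u u' : prefix u p -> prefix u' p -> size u <= size u' -> prefix u u'.
  rewrite !prefixE => /eqP eu /eqP eu' le_u.
  by rewrite -eu' take_takel // eu.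
wlog le_vw : c d v w / size v <= size w.
  move=> wl cv cw; have [/wl|/ltnW/wl] := leqP (size v) (size w); first exact.
  by move=> wl'; apply/esym/wl'.
move=> cv cw; have lt_w := closing_size cw; case: cv cw => pv _ uniq_v [pw sw _].
have := prefix_le _ _ pv pw; rewrite !size_rcons ltnS => /(_ le_vw).
rewrite prefix_rcons2 => /orP[pvw|/eqP/rcons_inj[]//].
have [q ep] := suffixP sw.
have /uniq_v q0 : prefix (rcons v c) (drop (size q) p) by rewrite ep drop_size_cat.
by move: lt_w; rewrite ep size_cat q0 ltnn.
Qed.

End Closed.

(** * Existence of a closing letter and comparison of words with the same first letter *)

Lemma closing_exists (p : seq letter) : p <> [::] ->
  (forall l c d s, c <> d ->
     ~ (infix (c :: rcons s c) (rcons p l) /\ infix (d :: rcons s d) (rcons p l))) ->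
  exists c v, closing p c v.
Proof.
move=> p_neq0 bal.
have p_gt0 : 0 < size p by case: (p) p_neq0.
(* [rep j] says that the prefix of length [j] recurs at a positive position; [j = 0] always
   qualifies, and the maximal [j] gives [v]. *)
pose rep j := (j < size p) &&
  has (fun i => prefix (take j p) (drop i p)) (iota 1 (size p)).
have rep0 : exists j, rep j.
  exists 0; rewrite /rep p_gt0; apply/hasP; exists 1; last by rewrite take0 prefix0s.
  by rewrite mem_iota; lia.
have rep_le j : rep j -> j <= size p by case/andP => /ltnW.
case: (ex_maxnP rep0 rep_le) => j /andP[lt_j /hasP[i i_in pi]] max_j.
rewrite mem_iota in i_in.
pose v := take j p; pose c := nth La p j.
have vc : rcons v c = take j.+1 p by rewrite (take_nth La).
have uniq_v k : prefix (rcons v c) (drop k p) -> k = 0.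
  move=> pk; apply/eqP; rewrite -leqn0 leqNgt; apply/negP => k_gt0.
  have le_jk : j < size p - k.
    by have := size_prefix pk; rewrite size_rcons size_drop size_take lt_j.
  suff /max_j : rep j.+1 by rewrite ltnn.
  have lt_j1 : j.+1 < size p by lia.
  by rewrite /rep lt_j1; apply/hasP; exists k; [rewrite mem_iota; lia|rewrite -vc].
exists c, v; split=> //; first by rewrite vc prefix_take.
apply: contraT => nsuf.
have le_ji : j <= size p - i.
  by have := size_prefix pi; rewrite size_drop size_take lt_j.
have le_ij : i + j <= size p by lia.
pose d := nth La p (i + j).
have [lt_ij|ge_ij] := ltnP (i + j) (size p); last first.
  case/negP: nsuf; apply/suffixP; exists (take i p).
  rewrite -{1}(cat_take_drop i p); congr cat; apply/eqP.
  have le_dj : size (drop i p) <= j by rewrite size_drop; lia.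
  by move: pi; rewrite prefixE size_take lt_j -/v take_oversize.
have pid : prefix (rcons v d) (drop i p).
  have lt_dj : j < size (drop i p) by rewrite size_drop; lia.
  move: pi; rewrite !prefixE size_rcons size_take lt_j => /eqP pi.
  by rewrite (take_nth La) // pi nth_drop.
have ncd : c <> d.
  by move=> ecd; move: pid; rewrite -ecd => /uniq_v; lia.
have le_vp : size v <= size p by rewrite size_take lt_j ltnW.
have [r [c' [q [d' [s [ev ep nc]]]]]] : exists (r : seq letter) c' q d' s,
    [/\ v = r ++ c' :: s, p = q ++ d' :: s & c' <> d'].
  exact: last_difference.
(* Both letters follow [v] in [p], so both follow its suffix [c' s]; taking [l = c'] gives
   [c' s c'], while [d' s d'] ends [rcons p d']. *)
have ext l : infix (c' :: rcons s l) p.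
  have ivl : infix (rcons v l) p -> infix (c' :: rcons s l) p.
    apply: infix_trans; rewrite ev rcons_cat rcons_cons.
    exact/infix_catl/infix_refl.
  have ivc : infix (rcons v c) p by rewrite vc; apply: infix_take.
  have ivd : infix (rcons v d) p.
    exact: infix_trans (prefixW pid) (infix_drop _ _).
  have ed := swap_neq ncd; apply: ivl; move: ivc ivd; rewrite ed.
  by case: (c); case: l.
case: (bal d' c' d' s nc); split.
  exact: infix_trans (ext c') (infix_rcons _ _).
by rewrite ep rcons_cat rcons_cons; apply/infix_catl/infix_refl.
Qed.

Lemma sturmian_prefix_eq (u v : seq letter) :
  sturmian (Fin u) -> sturmian (Fin v) -> size u = size v ->
  head La u = head La v ->
  (forall n, n < size u -> closedb (take n.+1 u) = closedb (take n.+1 v)) ->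
  u = v.
Proof.
move=> [x stx Fu] [y sty Fv] suv huv oc_uv.
apply/eqP; apply: contraT => /eqP nuv.
have [p [c [d [u' [v' [eu ev ncd]]]]]] : exists (p : seq letter) c d u' v',
    [/\ u = p ++ c :: u', v = p ++ d :: v' & c <> d].
  exact: first_difference.
have p_neq0 : p <> [::].
  by move=> p0; move: huv; rewrite eu ev p0 /=.
have pc : infix (rcons p c) u by rewrite eu -cat_rcons; apply/infix_catr/infix_refl.
have pd : infix (rcons p d) v by rewrite ev -cat_rcons; apply/infix_catr/infix_refl.
have oc_p : closedb (rcons p c) = closedb (rcons p d).
  have := oc_uv (size p); rewrite eu ev -!cat_rcons !take_size_cat ?size_rcons //.
  by apply; rewrite size_cat size_rcons; lia.
have ed := swap_neq ncd.
(* Any letter [l] is [c] or [d], so [rcons p l] occurs in [x] or in [y], and balance of that single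
   word suffices. *)
have bal l c1 d1 s : c1 <> d1 ->
    ~ (infix (c1 :: rcons s c1) (rcons p l) /\ infix (d1 :: rcons s d1) (rcons p l)).
  move=> n1 [i1 i2].
  have [z stz Fz] : exists2 z, sturmian_inf z & factor_inf (rcons p l) z.
    have [el|/eqP/nesym/swap_neq el] := eqVneq l c.
      by exists x => //; rewrite el; apply: infix_factor pc Fu.
    by exists y => //; rewrite el -ed; apply: infix_factor pd Fv.
  apply: (sturmian_balanced stz n1 (s := s)).
  by split; [apply: infix_factor i1 Fz|apply: infix_factor i2 Fz].
have [e [w cl_w]] := closing_exists p_neq0 bal.
have closed_e : closedb (rcons p e) by apply/closedP/closing_closed/cl_w.
have only_e l : closedb (rcons p l) -> e = l.
  by move=> /closedP/(closed_closing p_neq0)[w' /(closing_unique cl_w)].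
(* The closing letter [e] is [c] or [d]; equal [oc] entries make both extensions closed, so [e]
   equals both letters. *)
have closed_c : closedb (rcons p c).
  have [<-//|/eqP/nesym/swap_neq ee] := eqVneq e c.
  by rewrite oc_p ed -ee.
by case: ncd; rewrite -(only_e c closed_c); apply: only_e; rewrite -oc_p.
Qed.

(** * Exchange of the two letters and reduction to equal first letters *)

Lemma factor_inf_map (A B : Type) (f : A -> B) (u : seq A) (x : nat -> A) :
  factor_inf u x -> factor_inf (map f u) (f \o x).
Proof.
by case=> i e; exists i; rewrite size_map {1}e /mkseq -map_comp.
Qed.

Lemma closed_word_map (A B : eqType) (f : A -> B) (w : seq A) :
  injective f -> closed_word w -> closed_word (map f w).
Proof.
move=> f_inj [->|[v [nvw pv sv occ]]]; [by left|right; exists (map f v)].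
have prefix_map u z : prefix (map f u) (map f z) = prefix u z.
  by rewrite !prefixE size_map -map_take inj_eq //; apply: inj_map.
split.
- by move/(inj_map f_inj).
- by rewrite prefix_map.
- by case/suffixP: sv => t ->; rewrite map_cat suffix_suffix.
rewrite -occ /occurrences size_map; congr size; apply: eq_filter => i.
by rewrite -map_drop prefix_map.
Qed.

Lemma map_swapK : involutive (map swap).
Proof. exact: mapK swapK. Qed.

Lemma closedb_swap w : closedb (map swap w) = closedb w.
Proof.
have swap_inj := inv_inj swapK.
apply/closedP/closedP => [|/(closed_word_map swap_inj)//].
by move=> /(closed_word_map swap_inj); rewrite map_swapK.
Qed.

Lemma sturmian_inf_swap x : sturmian_inf x -> sturmian_inf (swap \o x).
Proof.
move=> stx n; have [s [us ss mem_s]] := stx n.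
exists (map (map swap) s); split; rewrite ?size_map //.
  by rewrite map_inj_uniq //; apply: inv_inj map_swapK.
move=> u; rewrite -{1}[u]map_swapK (mem_map (inv_inj map_swapK)) mem_s size_map.
split=> -[-> /(factor_inf_map swap)]; rewrite ?map_swapK => F; split=> //.
case: F => i ->; exists i; rewrite size_mkseq.
by apply: eq_map => j /=; rewrite swapK.
Qed.

Lemma sturmian_swap w : sturmian w -> sturmian (map_word swap w).
Proof.
case: w => [s [x stx Fs]|x] /=; last exact: sturmian_inf_swap.
by exists (swap \o x); [apply: sturmian_inf_swap|apply: factor_inf_map].
Qed.

Lemma oc_swap w : oc (map_word swap w) = oc w.
Proof.
case: w => [s|x] /=.
  rewrite size_map; congr Fin; apply: eq_map => i.
  by rewrite -map_take closedb_swap.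
congr Inf; apply: functional_extensionality => i.
by rewrite -[RHS]closedb_swap /mkseq -map_comp.
Qed.

Definition first_letter (w : word letter) :=
  match w with Fin s => head La s | Inf x => x 0 end.

Lemma sturmian_oc_inj w w' : sturmian w -> sturmian w' ->
  first_letter w = first_letter w' -> oc w = oc w' -> w = w'.
Proof.
case: w w' => [s|x] [s'|x'] //= st st' e0 [] oc_eq.
  have ss : size s = size s' by have := congr1 size oc_eq; rewrite !size_mkseq.
  congr Fin; apply: sturmian_prefix_eq => // n lt_n.
  have := congr1 (fun t => nth false t n) oc_eq.
  by rewrite !nth_mkseq // -ss.
congr Inf; apply: functional_extensionality => n.
(* Infinite words are compared through their prefixes of length [n + 1], which contain the letter at
   index [n]. *)
suff e : block x n.+1 0 = block x' n.+1 0.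
  by have := congr1 (fun t => nth La t n) e; rewrite !nth_block.
apply: sturmian_prefix_eq; rewrite ?size_block //.
- by exists x => //; apply: block_factor.
- by exists x' => //; apply: block_factor.
move=> k lt_k; have take_block z : take k.+1 (block z n.+1 0) = mkseq z k.+1.
  by rewrite /block /mkseq -map_take take_iota (minn_idPl lt_k).
by rewrite !take_block; apply: (congr1 (@^~ k) oc_eq).
Qed.

Theorem theorem9 (w w' : word letter) (hw : sturmian w) (hw' : sturmian w')
    (hoc : oc w = oc w') :
  w' = w \/ w' = map_word swap w.
Proof.
have [e0|/eqP/swap_neq e0] := eqVneq (first_letter w) (first_letter w').
  by left; apply: sturmian_oc_inj.
right; apply: sturmian_oc_inj; rewrite ?oc_swap //; first exact: sturmian_swap.
case: w w' {hw hw'} hoc e0 => [[|c s]|x] [[|c' s']|x'] //= [].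
Qed.
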